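(* Let $G$ be a subgroup of $PL_o(I)$ and let $n\geq 0$ be an integer. Then $G$ is solvable with derived length $n$ if and only if $G$ has depth $n$.
   Context: $PL_o(I)$ is the group of orientation-preserving piecewise-linear homeomorphisms of $I=[0,1]$ with finitely many breaks in slope; elements act on the right ($x\mapsto xg$). The support of $g$ is the open set of points moved by $g$; an orbital of $g$ is a connected component of its support. A signed orbital of $G$ is a pair $(A,g)$ with $g\in G$ and $A$ an orbital of $g$. A tower of $G$ is a set $T$ of signed orbitals of $G$ such that no two elements of $T$ have the same orbital and the orbitals of the elements of $T$ are pairwise comparable under inclusion (equivalently, $T$ is a chain in the partial order on signed orbitals given lexicographically by inclusion of orbitals and then a total order on $PL_o(I)$, with each orbital occurring at most once). The height of a tower is its cardinality, and the depth of $G$ is the supremum of the heights of the towers of $G$. The trivial group has derived length $0$. *)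

(* Defs.v *)
From HB Require Import structures.
From mathcomp Require Import all_boot all_order all_algebra.
From mathcomp Require Import all_classical all_reals all_analysis.
Set Implicit Arguments. Unset Strict Implicit. Unset Printing Implicit Defensive.
Import Order.TTheory GRing.Theory Num.Theory.
Import numFieldNormedType.Exports.
Local Open Scope classical_set_scope.
Local Open Scope ring_scope.

Section PL.
Variable R : realType.

Definition unitI : set R := [set x | 0 <= x <= 1].

(* Elements of PL_o(I) are represented as functions R -> R that are the
   identity outside [0,1]. *)
Definition is_PLo (f : R -> R) : Prop :=
  (forall x, ~ unitI x -> f x = x) /\
  {in unitI &, forall x y, x < y -> f x < f y} /\
  {within unitI, continuous f} /\
  f @` unitI = unitI /\
  (* piecewise linear with finitely many breaks: breakpoints
     0 < s_1 < ... < s_k < 1, affine on each piece *)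
  (exists s : seq R, path (<%R) 0 (rcons s 1) /\
     forall ab, ab \in zip (0 :: s) (rcons s 1) ->
       exists m c : R, forall x, ab.1 <= x <= ab.2 -> f x = m * x + c).

Definition is_subgroup_PLo (G : set (R -> R)) : Prop :=
  G `<=` is_PLo /\
  G (fun x => x) /\
  (forall g h, G g -> G h -> G (g \o h)) /\
  (forall g, G g -> exists h, G h /\ g \o h = (fun x => x) /\ h \o g = (fun x => x)).

Inductive comm_gen (H : set (R -> R)) : (R -> R) -> Prop :=
  | cg_comm a b ai bi : H a -> H b -> H ai -> H bi ->
      ai \o a = (fun x => x) -> a \o ai = (fun x => x) ->
      bi \o b = (fun x => x) -> b \o bi = (fun x => x) ->
      comm_gen H (b \o a \o bi \o ai)
  | cg_id : comm_gen H (fun x => x)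
  | cg_mul x y : comm_gen H x -> comm_gen H y -> comm_gen H (x \o y)
  | cg_inv x y : comm_gen H x -> x \o y = (fun x => x) -> y \o x = (fun x => x) ->
      comm_gen H y.

Definition derived (H : set (R -> R)) : set (R -> R) := comm_gen H.

Definition derived_series (G : set (R -> R)) (k : nat) : set (R -> R) :=
  iter k derived G.

Definition solvable_derived_length (G : set (R -> R)) (n : nat) : Prop :=
  derived_series G n = [set (fun x => x)] /\
  forall m, (m < n)%N -> derived_series G m <> [set (fun x => x)].

Definition supp (g : R -> R) : set R := [set x | g x <> x].

Definition orbital (g : R -> R) (A : set R) : Prop :=
  exists x, supp g x /\ A = connected_component (supp g) x.

Definition tower (G : set (R -> R)) (T : set (set R * (R -> R))) : Prop :=
  (forall p, T p -> G p.2 /\ orbital p.2 p.1) /\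
  (forall p q, T p -> T q -> p.1 = q.1 -> p = q) /\
  (forall p q, T p -> T q -> p.1 `<=` q.1 \/ q.1 `<=` p.1).

Definition has_depth (G : set (R -> R)) (n : nat) : Prop :=
  (exists T, tower G T /\ (T #= `I_n)%card) /\
  (forall T, tower G T -> (T #<= `I_n)%card).

End PL.

(* Main.v *)
Require Import Defs.
From mathcomp Require Import all_boot all_order all_algebra.
From mathcomp Require Import all_classical all_reals all_analysis.
From mathcomp Require Import lra.
Set Implicit Arguments. Unset Strict Implicit. Unset Printing Implicit Defensive.
Import Order.TTheory GRing.Theory Num.Theory.
Import numFieldNormedType.Exports.
Local Open Scope classical_set_scope.
Local Open Scope ring_scope.

(* Call G one-sided if some element of G fixes the left end p and moves the
   right end x of an orbital (p, x) of another element f. Conjugating f yields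
   nested orbitals (p, x_i), so G has towers of every height. Moreover some
   commutator moves x and is trivial near p; conjugating it by f gives nested or
   crossing orbitals around x, so G' has towers of every height too. Two
   orbitals that cross already make G one-sided: look at the leftmost point of
   the connected component of the union of the two supports.

   If G is not one-sided, an orbital (a, b) of an element of G' lies strictly
   inside an orbital of G: otherwise G fixes a, and elements of G' have slope 1
   at a because the slope is a homomorphism. So passing to G' loses at least one
   level. If moreover the mirror image of G is not one-sided, it loses only one:
   if (a', b') lies strictly inside (a, b) with f and g acting on them, f is
   trivial near a and b, a power k of g pushes the support of f in (a, b) off
   itself, and the commutator k f^-1 k^-1 f agrees with f on (a', b'). By
   induction, the n-th derived group is trivial exactly when there is no tower
   of height n + 1. *)

Section PLgroups.
Variable R : realType.
Implicit Types (G H : set (R -> R)) (f g h k : R -> R).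

(** * Right germs, reflection and an abstract class of groups *)

Definition rgerm f p l :=
  exists2 e, 0 < e & forall t, p <= t <= p + e -> f t = p + l * (t - p).

(* Conjugation by [t |-> 1 - t], used to deduce statements about right ends of
   orbitals and left germs from those about left ends and right germs. *)
Definition mirror f : R -> R := fun t => 1 - f (1 - t).

Lemma mirrorK : involutive mirror.
Proof. by move=> f; apply/funext => t; rewrite /mirror !subKr. Qed.

Lemma mirror_comp f g : mirror (f \o g) = mirror f \o mirror g.
Proof. by apply/funext => t; rewrite /mirror /= subKr. Qed.

Lemma mirror_id : mirror (fun x => x) = (fun x => x).
Proof. by apply/funext => t; rewrite /mirror subKr. Qed.

Definition mirror_set G : set (R -> R) := [set f | G (mirror f)].

(** These properties pass to derived groups and to reflections, so the induction stays within the
    class. Left germs are stated as right germs of the mirror, so that reflection merely swaps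
    fields. *)
Record germ_group G : Prop := GermGroup {
  gg_lt : forall f, G f -> {homo f : x y / x < y};
  gg_le0 : forall f x, G f -> x <= 0 -> f x = x;
  gg_ge1 : forall f x, G f -> 1 <= x -> f x = x;
  gg_germ : forall f p, G f -> f p = p -> exists l, rgerm f p l;
  gg_mgerm : forall f p, G f -> mirror f p = p ->
    exists l, rgerm (mirror f) p l;
  gg_id : G (fun x => x);
  gg_comp : forall f g, G f -> G g -> G (f \o g);
  gg_inv : forall f, G f -> exists f', [/\ G f', cancel f f' & cancel f' f] }.

Lemma mirror_group G : germ_group G -> germ_group (mirror_set G).
Proof.
move=> gG; split =>
  [f Gf x y xy|f x Gf x0|f x Gf x1|f p Gf fp|f p Gf fp||f g Gf Gg|f Gf].
- have := gg_lt gG Gf (x := 1 - y) (y := 1 - x).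
  by rewrite /mirror !subKr => /(_ ltac:(lra)); lra.
- have := gg_ge1 gG (x := 1 - x) Gf.
  by rewrite /mirror !subKr => /(_ ltac:(lra)); lra.
- have := gg_le0 gG (x := 1 - x) Gf.
  by rewrite /mirror !subKr => /(_ ltac:(lra)); lra.
- by have := gg_mgerm gG (p := p) Gf; rewrite mirrorK; apply.
- exact: (gg_germ gG Gf fp).
- by rewrite /mirror_set /= mirror_id; exact: gg_id.
- by rewrite /mirror_set /= mirror_comp; exact: gg_comp.
- have [h [Gh fh hf]] := gg_inv gG Gf.
  exists (mirror h); rewrite /mirror_set /= mirrorK; split => // t.
    have := fh (1 - t); rewrite /mirror !subKr => ->; by rewrite subKr.
  by have := hf (1 - t); rewrite /mirror; lra.
Qed.

Lemma gg_leE G f : germ_group G -> G f -> {mono f : x y / x <= y}.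
Proof. by move=> gG Gf; apply: le_mono; exact: gg_lt gG _ Gf. Qed.

Lemma gg_ltE G f : germ_group G -> G f -> {mono f : x y / x < y}.
Proof. by move=> gG Gf; apply: leW_mono; exact: gg_leE gG Gf. Qed.

(** * Derived groups *)

Lemma derived_sub G : germ_group G -> derived G `<=` G.
Proof.
move=> gG f; elim=>
  [a b ai bi Ga Gb Gai Gbi _ _ _ _||x y _ Gx _ Gy|x y _ Gx xy yx].
- by do !apply: gg_comp => //.
- exact: gg_id.
- exact: gg_comp.
- have [h [Gh xh hx]] := gg_inv gG Gx.
  suff -> : y = h by [].
  by apply/funext => t; rewrite -[LHS]xh; congr h; exact: (congr1 (@^~ t) xy).
Qed.

Lemma derived_group G : germ_group G -> germ_group (derived G).
Proof.
move=> gG; have sG := derived_sub gG; split=>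
  [f /sG|f x /sG|f x /sG|f p /sG|f p /sG||f g|f df].
- exact: gg_lt.
- exact: gg_le0.
- exact: gg_ge1.
- exact: gg_germ.
- exact: gg_mgerm.
- exact: cg_id.
- exact: cg_mul.
- have [h [Gh fh hf]] := gg_inv gG (sG _ df).
  by exists h; split => //; apply: (cg_inv df); apply/funext.
Qed.

Lemma derived_mono G H : G `<=` H -> derived G `<=` derived H.
Proof.
move=> GH f; elim=>
  [a b ai bi Ga Gb Gai Gbi *||x y _ Gx _ Gy|x y _ Gx xy yx].
- by apply: cg_comm => //; exact: GH.
- exact: cg_id.
- exact: cg_mul.
- exact: cg_inv Gx xy yx.
Qed.

(** Reflection respects composition, hence commutators; this gives one inclusion, and the other is
    the same inclusion for the reflected group. *)
Lemma derived_mirror G : derived (mirror_set G) = mirror_set (derived G).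
Proof.
have sub H : derived (mirror_set H) `<=` mirror_set (derived H).
  rewrite /mirror_set => f /=; elim=>
    [a b ai bi Ga Gb Gai Gbi e1 e2 e3 e4||x y _ Gx _ Gy|x y _ Gx xy yx].
  - rewrite 3!mirror_comp; apply: cg_comm => //;
      rewrite -mirror_comp ?e1 ?e2 ?e3 ?e4 mirror_id //.
  - by rewrite mirror_id; exact: cg_id.
  - by rewrite mirror_comp; exact: cg_mul.
  - by apply: cg_inv Gx _ _; rewrite -mirror_comp ?xy ?yx mirror_id.
apply/seteqP; split => [|f df]; first exact: sub.
have := sub (mirror_set G) (mirror f).
rewrite (_ : mirror_set (mirror_set G) = G) => [H|]; last first.
  by apply/seteqP; split => g; rewrite /mirror_set /= mirrorK.
rewrite -[f]mirrorK; apply: H; exact: df.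
Qed.

(** * Slopes of germs at fixed points *)

Lemma rgerm_gt0 f p l : {homo f : x y / x < y} -> rgerm f p l -> 0 < l.
Proof.
move=> mf [e e0 fe]; have := mf p (p + e).
rewrite (fe p) ?(fe (p + e)); try lra.
by move=> /(_ ltac:(lra)); rewrite -(pmulr_lgt0 l e0); lra.
Qed.

Lemma rgerm_comp f g p l m : {homo g : x y / x < y} ->
  rgerm f p l -> rgerm g p m -> rgerm (f \o g) p (l * m).
Proof.
move=> mg rf rg; have m0 := rgerm_gt0 mg rg.
case: rf rg => e e0 fe [d d0 gd].
(* Near [p] the map [g] stretches by [m], so the radius [e / m] keeps its values where [f] is
   affine. *)
exists (Num.min d (e / m)); first by rewrite lt_min d0 divr_gt0.
move=> t /andP[pt]; rewrite -lerBlDl le_min => /andP[td tm].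
rewrite /= gd; last by rewrite pt -lerBlDl.
have tm1 : m * (t - p) <= e by rewrite mulrC -ler_pdivlMr.
have tm0 : 0 <= m * (t - p) by rewrite mulr_ge0 ?subr_ge0 // ltW.
by rewrite fe; lra.
Qed.

Lemma rgerm_uniq f p l m : rgerm f p l -> rgerm f p m -> l = m.
Proof.
move=> [e e0 fe] [d d0 fd].
have c0 : 0 < Num.min e d by rewrite lt_min e0.
have ce : Num.min e d <= e by rewrite ge_min lexx.
have cd : Num.min e d <= d by rewrite ge_min lexx orbT.
move: (Num.min e d) c0 ce cd => c c0 ce cd.
have := fe (p + c) ltac:(lra); rewrite fd; last lra.
move=> lm; apply: (mulIf (lt0r_neq0 c0)); lra.
Qed.

Lemma rgerm_id p : rgerm (fun x : R => x) p 1.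
Proof. by exists 1 => // t _; lra. Qed.

(* The slope at a common fixed point is a homomorphism to an abelian group. *)
Lemma derived_rgerm G p f : germ_group G -> (forall g, G g -> g p = p) ->
  derived G f -> rgerm f p 1.
Proof.
move=> gG fixp.
have inv1 x y l m : G x -> G y -> rgerm x p l -> rgerm y p m ->
    x \o y = (fun t => t) -> l * m = 1.
  move=> Gx Gy rx ry xy; apply: (@rgerm_uniq (x \o y) p).
    exact: rgerm_comp (gg_lt gG Gy) rx ry.
  by rewrite xy; exact: rgerm_id.
elim=> [a b ai bi Ga Gb Gai Gbi ea _ _ eb||x y dx rx dy ry|x y dx rx xy yx].
- have [l rl] := gg_germ gG Ga (fixp _ Ga).
  have [l' rl'] := gg_germ gG Gai (fixp _ Gai).
  have [m rm] := gg_germ gG Gb (fixp _ Gb).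
  have [m' rm'] := gg_germ gG Gbi (fixp _ Gbi).
  have ll := inv1 _ _ _ _ Gai Ga rl' rl ea.
  have mm := inv1 _ _ _ _ Gb Gbi rm rm' eb.
  have -> : 1 = m * l * m' * l' :> R.
    by rewrite (mulrAC m) mm mul1r mulrC.
  by do !(apply: rgerm_comp => //; first by apply: gg_lt gG _ _).
- exact: rgerm_id.
- rewrite -[1]mulr1; apply: rgerm_comp => //.
  exact: (gg_lt gG (derived_sub gG dy)).
- have Gy : G y by apply: (derived_sub gG); exact: cg_inv dx xy yx.
  have [l rl] := gg_germ gG Gy (fixp _ Gy).
  have := inv1 _ _ _ _ (derived_sub gG dx) Gy rx rl xy.
  by rewrite mul1r => <-.
Qed.

(** * Orbitals as open intervals *)

(** Orbitals are handled through their end points; [orb_component] matches this with connected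
    components of the support. *)
Definition orb f a b :=
  [/\ a < b, f a = a, f b = b & forall t, a < t < b -> f t <> t].

Lemma orb_mirror f a b : orb f a b -> orb (mirror f) (1 - b) (1 - a).
Proof.
move=> [ab fa fb fab]; split; rewrite /mirror ?subKr ?fa ?fb //; first lra.
by move=> t tab; have := fab (1 - t) ltac:(lra); lra.
Qed.

(** An increasing bijection preserves suprema. *)
Lemma fixed_sup G f (S : set R) : germ_group G -> G f -> has_sup S ->
  (forall t, S t -> f t = t) -> f (sup S) = sup S.
Proof.
move=> gG Gf hS fS; have [h [Gh fh hf]] := gg_inv gG Gf.
have le : sup S <= f (sup S).
  apply: ge_sup; first by case: hS.
  move=> t St; rewrite -(fS t St) (gg_leE gG Gf).
  by apply: ub_le_sup => //; case: hS.
apply/eqP; rewrite eq_le le andbT leNgt; apply/negP => lt.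
have : h (sup S) < sup S by rewrite -(gg_ltE gG Gf) hf.
move=> /sup_gt => /(_ ltac:(by case: hS)) [t St].
rewrite -(gg_ltE gG Gf) hf (fS t St) => /lt_le_trans; move=> /(_ (sup S)).
rewrite ltxx => H; apply/notF/H; apply: ub_le_sup => //; by case: hS.
Qed.

Lemma left_end G f x : germ_group G -> G f -> f x <> x ->
  exists a, [/\ a < x, f a = a & forall t, a < t <= x -> f t <> t].
Proof.
move=> gG Gf fx; have x0 : 0 < x.
  by rewrite ltNge; apply/negP => x0; apply: fx; exact: (gg_le0 gG Gf x0).
(* The left end is the largest fixed point up to [x]; 0 is such a fixed point. *)
pose S := [set t | t <= x /\ f t = t].
have hS : has_sup S.
  split; last by exists x => t [].
  by exists 0; split; [exact: ltW|exact: (gg_le0 gG Gf (lexx _))].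
have fs : f (sup S) = sup S by apply: (fixed_sup gG Gf hS) => t [].
have sx : sup S <= x by apply: ge_sup; [case: hS|move=> t []].
exists (sup S); split => // [|t /andP[st tx] ft].
  by rewrite lt_neqAle sx andbT; apply/eqP => e; apply: fx; rewrite -e.
by move: st; rewrite ltNge => /negP; apply; apply: ub_le_sup; [case: hS|].
Qed.

Lemma orb_ex G f x : germ_group G -> G f -> f x <> x ->
  exists a b, orb f a b /\ a < x < b.
Proof.
move=> gG Gf fx; have [a [ax fa fax]] := left_end gG Gf fx.
(* The right end is the reflected left end for the mirrored map. *)
have [] := @left_end _ (mirror f) (1 - x) (mirror_group gG).
- by rewrite /mirror_set /= mirrorK.
- by rewrite /mirror subKr; lra.
rewrite /mirror => b [bx fb fbx]; exists a, (1 - b); split; last by lra.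
split => //; [lra|lra|move=> t /andP[at_ tb]].
have [tx|xt] := leP t x; first by apply: fax; rewrite at_.
by have := fbx (1 - t) ltac:(lra); rewrite subKr; lra.
Qed.

Lemma orb_eq f a b c d : orb f a b -> orb f c d -> a < d -> c < b ->
  a = c /\ b = d.
Proof.
move=> [ab fa fb fab] [cd fc fd fcd] ad cb.
have [ac|ca|<-] := ltgtP a c; first by have := fab c ltac:(lra).
  by have := fcd a ltac:(lra).
have [bd|db|//] := ltgtP b d; first by have := fcd b ltac:(lra).
by have := fab d ltac:(lra).
Qed.

Lemma orb_conj G c k k' a b : germ_group G -> G k -> cancel k k' ->
  cancel k' k -> orb c a b -> orb (k \o c \o k') (k a) (k b).
Proof.
move=> gG Gk kk' k'k [ab ca cb cab]; split.
- by rewrite (gg_ltE gG Gk).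
- by rewrite /= kk' ca.
- by rewrite /= kk' cb.
- move=> t; rewrite -{1 2}(k'k t) !(gg_ltE gG Gk) => /cab ct /=.
  by move=> /(congr1 k'); rewrite kk'.
Qed.

(** Piecewise linearity enters here: a germ of slope 1 is the identity, and any other slope moves
    every point just right of [p], so an orbital starts at [p]. *)
Lemma germ_cases G f p : germ_group G -> G f -> f p = p ->
  (exists2 e, 0 < e & forall t, p <= t <= p + e -> f t = t) \/
  exists x, orb f p x.
Proof.
move=> gG Gf fp; have [l [e e0 fe]] := gg_germ gG Gf fp.
have [l1|/eqP l1] := eqVneq l 1.
  by left; exists e => // t /fe ->; rewrite l1; lra.
right; have mv t : p < t <= p + e -> f t <> t.
  move=> pt ft; apply: l1; have := fe t ltac:(lra).
  have tp0 : t - p != 0 by rewrite subr_eq0 gt_eqF; lra.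
  by rewrite ft => H; apply: (mulIf tp0); lra.
have [a [b [fab pab]]] := @orb_ex _ f (p + e) gG Gf (mv (p + e) ltac:(lra)).
have [ab fa fb fx] := fab.
suff <- : a = p by exists b.
have [ap|pa|//] := ltgtP a p; first by have := fx p ltac:(lra).
by have := mv a ltac:(lra).
Qed.

Lemma orb_not_id f p x e : 0 < e -> (forall t, p <= t <= p + e -> f t = t) ->
  ~ orb f p x.
Proof.
move=> e0 fe [px fp fx fpx]; pose t := Num.min (p + e) ((p + x) / 2).
have tp : p < t by rewrite lt_min; apply/andP; split; lra.
have te : t <= p + e by rewrite ge_min lexx.
have tx : t <= (p + x) / 2 by rewrite ge_min lexx orbT.
by apply: (fpx t); [lra|apply: fe; lra].
Qed.

(** * Towers of nested orbitals *)

(* [`]a, b[] is the largest orbital of a tower of [G] of height [n.+1]. *)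
Fixpoint tower_top G n a b : Prop :=
  (exists2 g, G g & orb g a b) /\
  if n is m.+1 then
    exists a' b',
      [/\ tower_top G m a' b', a <= a', b' <= b & (a', b') <> (a, b)]
  else True.

Lemma tower_top_orb G n a b : tower_top G n a b -> exists2 g, G g & orb g a b.
Proof. by case: n => [|n] []. Qed.

Lemma tower_top_sub G H n a b :
  G `<=` H -> tower_top G n a b -> tower_top H n a b.
Proof.
move=> GH; elim: n a b => [|n IHn] a b /= [[g Gg gab]].
  by split => //; exists g => //; exact: GH.
move=> [a' [b' [/IHn tw' aa bb ab]]].
  split; first by exists g => //; exact: GH.
by exists a', b'.
Qed.

Lemma tower_top_conj G H k k' n a b : germ_group H -> H k -> cancel k k' ->
  cancel k' k -> (forall g, G g -> G (k \o g \o k')) ->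
  tower_top G n a b -> tower_top G n (k a) (k b).
Proof.
move=> gH Hk kk' k'k nG.
have top a1 b1 : (exists2 g, G g & orb g a1 b1) ->
    exists2 g, G g & orb g (k a1) (k b1).
  by move=> [g Gg gab]; exists (k \o g \o k');
    [exact: nG|exact: (orb_conj gH Hk)].
elim: n a b => [|n IHn] a b /= [/top gab]; first by split.
move=> [a' [b' [/IHn tw' aa bb ab]]]; split => //.
exists (k a'), (k b'); split => //; rewrite ?(gg_leE gH Hk) //.
by move=> [/(can_inj kk') e1 /(can_inj kk') e2]; apply: ab; rewrite e1 e2.
Qed.

(** Conjugation by [k] carries a tower with top [(a, b)] strictly inside [(a, b)], and [c] then
    provides a new top. The conjugator is taken from [H] so that [G] can be the derived group of
    [H]. *)
Lemma tower_top_contracting G H k k' c a b n : germ_group H -> H k ->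
  cancel k k' -> cancel k' k -> (forall g, G g -> G (k \o g \o k')) ->
  G c -> orb c a b -> a <= k a -> k b <= b -> (k a, k b) <> (a, b) ->
  tower_top G n a b.
Proof.
move=> gH Hk kk' k'k nG Gc cab ak kb ne.
elim: n => [|n IHn] /=; first by split => //; exists c.
split; first by exists c.
by exists (k a), (k b); split => //; exact: (tower_top_conj gH Hk).
Qed.

Lemma tower_top_mirror G n a b : tower_top G n a b ->
  tower_top (mirror_set G) n (1 - b) (1 - a).
Proof.
have top a1 b1 : (exists2 g, G g & orb g a1 b1) ->
    exists2 g, mirror_set G g & orb g (1 - b1) (1 - a1).
  move=> [g Gg gab]; exists (mirror g); last exact: orb_mirror.
  by rewrite /mirror_set /= mirrorK.
elim: n a b => [|n IHn] a b /= [/top gab]; first by split.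
move=> [a' [b' [/IHn tw' aa bb ab]]]; split => //.
exists (1 - b'), (1 - a'); split => //; [lra|lra|].
by move=> [e1 e2]; apply: ab; congr pair; lra.
Qed.

Lemma derived_normal G k k' f : G k -> G k' -> cancel k k' -> cancel k' k ->
  (forall g h, G g -> G h -> G (g \o h)) ->
  derived G f -> derived G (k \o f \o k').
Proof.
move=> Gk Gk' kk' k'k Gcomp.
have conjM x y : k \o (x \o y) \o k' = (k \o x \o k') \o (k \o y \o k').
  by apply/funext => t /=; rewrite kk'.
have conj1 : k \o (fun x => x) \o k' = (fun x => x).
  by apply/funext => t /=; rewrite k'k.
have Gconj x : G x -> G (k \o x \o k') by move=> Gx; do 2!apply: (Gcomp) => //.
elim=> [a b ai bi Ga Gb Gai Gbi e1 e2 e3 e4||x y _ Gx _ Gy|x y _ Gx xy yx].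
- rewrite 3!conjM; apply: cg_comm; rewrite -?conjM ?e1 ?e2 ?e3 ?e4 //;
    exact: Gconj.
- by rewrite conj1; exact: cg_id.
- by rewrite conjM; exact: cg_mul.
- by apply: cg_inv Gx _ _; rewrite -conjM ?xy ?yx conj1.
Qed.

(** * One-sided groups and their towers of every height *)

Definition one_sided G := exists f k p x,
  [/\ G f, G k, orb f p x, k p = p & k x <> x].

Lemma one_sided_lt G : germ_group G -> one_sided G -> exists f k k' p x,
  [/\ G f, G k & G k'] /\
  [/\ cancel k k', cancel k' k, orb f p x, k p = p & k x < x].
Proof.
move=> gG [f [k [p [x [Gf Gk fpx kp kx]]]]].
have [k' [Gk' kk' k'k]] := gg_inv gG Gk.
have [lt|lt|//] := ltgtP (k x) x; first by exists f, k, k', p, x.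
exists f, k', k, p, x; split => //; split => //; first by rewrite -{1}kp kk'.
by rewrite -(gg_ltE gG Gk) k'k.
Qed.

Lemma one_sided_tower G n : germ_group G -> one_sided G ->
  exists a b, tower_top G n a b.
Proof.
move=> gG /(one_sided_lt gG)[f [k [k' [p [x [[Gf Gk Gk']
  [kk' k'k fpx kp kx]]]]]]].
exists p, x.
apply: (tower_top_contracting (H := G) (k := k) (k' := k') (c := f)) => //.
- by move=> g Gg; do 2!apply: (gg_comp gG) => //.
- by rewrite kp.
- exact: ltW.
- by move=> [_ e]; rewrite e ltxx in kx.
Qed.

(** Let [p] be the largest common fixed point up to [a]; there is none in [(p, d)]. So [g] and [h]
    are not both trivial right of [p], and one of them has an orbital [(p, x)]. Then [x < d], so the
    other element moves [x]. *)
Lemma crossing_one_sided G g h a b c d : germ_group G -> G g -> G h ->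
  orb g a b -> orb h c d -> a < c -> c < b -> b < d -> one_sided G.
Proof.
move=> gG Gg Gh gab hcd ac cb bd.
have [_ ga gb gx] := gab; have [_ hc hd hx] := hcd.
pose S := [set t | [/\ t <= a, g t = t & h t = t]].
have hS : has_sup S.
  split; last by exists a => t [].
  have a0 : Num.min a 0 <= 0 by rewrite ge_min lexx orbT.
  exists (Num.min a 0); split; first by rewrite ge_min lexx.
    exact: (gg_le0 gG Gg).
  exact: (gg_le0 gG Gh).
have gp : g (sup S) = sup S by apply: (fixed_sup gG Gg hS) => t [].
have hp : h (sup S) = sup S by apply: (fixed_sup gG Gh hS) => t [].
have pa : sup S <= a by apply: ge_sup; [case: hS|move=> t []].
have nocommon t : sup S < t < d -> g t = t -> h t = t -> False.
  move=> /andP[pt td] gt ht; have [ta|at_] := leP t a.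
    move: pt; rewrite ltNge => /negP; apply.
    by apply: ub_le_sup; [case: hS|].
  have [tb|bt] := ltP t b; first by apply: (gx t) => //; rewrite at_.
  by apply: (hx t) => //; rewrite td (lt_le_trans cb).
move: (sup S) gp hp pa nocommon => p gp hp pa nocommon.
have [[e e0 ge]|[x gpx]] := germ_cases gG Gg gp; last first.
  exists g, h, p, x; split => // hx'; have [px _ gx' gx0] := gpx.
  apply: (nocommon x) => //; rewrite px /= (le_lt_trans _ bd) //.
  by rewrite leNgt; apply/negP => bx; apply: (gx0 b) => //; lra.
have [[e' e'0 he]|[x hpx]] := germ_cases gG Gh hp; last first.
  exists h, g, p, x; split => // gx'; have [px _ hx' hx0] := hpx.
  apply: (nocommon x) => //; rewrite px /= (le_lt_trans _ (lt_trans cb bd)) //.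
  by rewrite leNgt; apply/negP => bx; apply: (hx0 c) => //; lra.
have m0 : 0 < Num.min (d - p) (Num.min e e') by rewrite !lt_min e0 e'0; lra.
have m1 : Num.min (d - p) (Num.min e e') <= d - p by rewrite ge_min lexx.
have m2 : Num.min (d - p) (Num.min e e') <= e by rewrite !ge_min lexx orbT.
have m3 : Num.min (d - p) (Num.min e e') <= e' by rewrite !ge_min lexx !orbT.
move: (Num.min _ _) m0 m1 m2 m3 => m m0 m1 m2 m3.
by case: (nocommon (p + m / 2)); [lra|apply: ge; lra|apply: he; lra].
Qed.

Lemma one_sided_derived_tower G n : germ_group G -> one_sided G ->
  exists a b, tower_top (derived G) n a b.
Proof.
move=> gG /(one_sided_lt gG)[f [k [k' [p [x [[Gf Gk Gk']
  [kk' k'k fpx kp kx]]]]]]].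
have [f' [Gf' ff' f'f]] := gg_inv gG Gf.
have [px fp fx fne] := fpx.
have k'p : k' p = p by rewrite -{1}kp kk'.
have f'x : f' x = x by rewrite -{1}fx ff'.
have f'p : f' p = p by rewrite -{1}fp ff'.
(* Slope at [p] is a homomorphism on the stabiliser of [p] only, so the commutator is formed
   there. *)
pose S := [set g | G g /\ g p = p].
have gS : germ_group S.
  split=>
    [g [Gg _]|g y [Gg _]|g y [Gg _]|g y [Gg _]|g y [Gg _]||g h [Gg gp] [Gh hp]|g [Gg gp]].
  - exact: (gg_lt gG).
  - exact: (gg_le0 gG).
  - exact: (gg_ge1 gG).
  - exact: (gg_germ gG).
  - exact: (gg_mgerm gG).
  - by split => //; exact: (gg_id gG).
  - by split; [exact: (gg_comp gG)|rewrite /= hp].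
  - have [h [Gh gh hg]] := gg_inv gG Gg.
    by exists h; split => //; split => //; rewrite -{1}gp gh.
pose c := k' \o f \o k \o f'.
have dSc : derived S c.
  by apply: cg_comm; try (by split); apply/funext => t /=.
have dc : derived G c by apply: derived_mono dSc => g [].
have Gc := derived_sub gG dc.
have cp : c p = p by have [] := derived_sub gS dSc.
(* Since [f'] fixes [x], the equation [c x = x] would make [k x] a fixed point of [f] inside
   [(p, x)]. *)
have cx : c x <> x.
  rewrite /c /= f'x => /(congr1 k); rewrite k'k; apply: fne.
  by rewrite kx -{1}kp (gg_ltE gG Gk) px.
have [u [v [cuv uxv]]] := orb_ex gG Gc cx.
have [uv cu cv cne] := cuv.
(* [c] fixes [p], so [p] is not inside [(u, v)]; and [c] is trivial just right of [p], so no orbital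
   starts there. *)
have pu : p < u.
  rewrite ltNge le_eqVlt; apply/negP => /orP[/eqP up|up]; last first.
    by apply: (cne p) => //; lra.
  have [e e0 ce] := derived_rgerm gS (fun g Sg => proj2 Sg) dSc.
  rewrite up in cuv; apply: (orb_not_id e0 _ cuv) => t /ce ->; lra.
have dG := derived_group gG.
(* [u] lies in the orbital [(p, x)] of [f], so [f] or its inverse pushes [u] towards the fixed point
   [x]. *)
have [m [m' [[Gm Gm'] [mm' m'm mx um]]]] : exists m m', [/\ G m & G m'] /\
    [/\ cancel m m', cancel m' m, m x = x & u < m u].
  have := fne u ltac:(lra); have [fu|fu|//] := ltgtP (f u) u => _.
    by exists f', f; split => //; split => //; rewrite -(gg_ltE gG Gf) f'f.
  by exists f, f'.
have nG g : derived G g -> derived G (m \o g \o m').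
  by apply: derived_normal => // ? ?; exact: (gg_comp gG).
have [mv|vm] := leP (m v) v.
  exists u, v.
  apply: (tower_top_contracting n gG Gm mm' m'm nG dc cuv (ltW um) mv).
  by move=> [e _]; rewrite e ltxx in um.
(* Here [(u, v)] and its image cross, as [m u < m x = x < v], so the derived group is itself
   one-sided. *)
apply: (one_sided_tower n dG).
apply: (crossing_one_sided dG dc (nG _ dc) cuv (orb_conj gG Gm mm' m'm cuv)) => //.
by apply: (@lt_trans _ _ x); [rewrite -[ltRHS]mx (gg_ltE gG Gm)|]; lra.
Qed.

(** * Change of tower height along the derived series *)

(** Some element of [G] moves [a], as otherwise [f] would be trivial right of [a]. Its orbital
    around [a] must contain [(a, b)], since it would cross it otherwise. *)
Lemma derived_orb_up G f a b : germ_group G -> ~ one_sided G -> derived G f ->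
  orb f a b ->
  exists g c d, [/\ G g, orb g c d, c <= a, b <= d & (a, b) <> (c, d)].
Proof.
move=> gG nbad df fab; have Gf := derived_sub gG df.
have [g [Gg ga]] : exists g, G g /\ g a <> a.
  apply: contrapT => fixa; have [|e e0 fe] := @derived_rgerm _ a f gG _ df.
    by move=> g Gg; apply: contrapT => ga; apply: fixa; exists g.
  by apply: (orb_not_id e0 _ fab) => t /fe ->; lra.
have [c [d [gcd cad]]] := orb_ex gG Gg ga.
have [ab _ _ _] := fab.
exists g, c, d; split => //; first by lra.
- rewrite leNgt; apply/negP => db.
  by apply/nbad/(crossing_one_sided gG Gg Gf gcd fab); lra.
- by move=> [e _]; move: cad; rewrite e ltxx.
Qed.

Lemma tower_derived_up G n a b : germ_group G -> ~ one_sided G ->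
  tower_top (derived G) n a b -> exists c d, tower_top G n.+1 c d.
Proof.
move=> gG nbad tab; have [f df fab] := tower_top_orb tab.
have [g [c [d [Gg gcd ca bd ne]]]] := derived_orb_up gG nbad df fab.
exists c, d; split; first by exists g.
by exists a, b; split => //; exact: (tower_top_sub (derived_sub gG)).
Qed.

(** An orbital of [f] around [a] would cross [(a, b)] or meet [(a', b')], so [f] fixes [a]. If an
    orbital [(a, z)] of [f] started there, [z < b] would make [G] one-sided, and [b <= z] would
    force [(a', b') = (a, b)]. *)
Lemma id_near_end G g f a b a' b' :
  germ_group G -> ~ one_sided G -> G g -> G f ->
  orb g a b -> orb f a' b' -> a <= a' -> b' <= b -> (a', b') <> (a, b) ->
  exists2 e, 0 < e & forall t, a <= t <= a + e -> f t = t.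
Proof.
move=> gG nbad Gg Gf gab fab aa bb ne; have [ab ga gb gne] := gab.
have [ab' fa' fb' _] := fab.
have fa : f a = a.
  apply: contrapT => /(orb_ex gG Gf)[c [d [fcd cad]]].
  have [da|ad] := leP d a'.
    by apply/nbad/(crossing_one_sided gG Gf Gg fcd gab); lra.
  have [e _] := orb_eq fcd fab ltac:(lra) ltac:(lra); lra.
have [//|[z faz]] := germ_cases gG Gf fa.
have [bz|zb] := leP b z.
  have [e1 e2] := orb_eq faz fab ltac:(lra) ltac:(lra).
  by case: ne; congr pair; lra.
case: nbad; exists f, g, a, z; split => //; apply: gne.
by have [-> _ _ _] := faz.
Qed.

(** The iterates of [u] under [g] or its inverse increase; if they stayed below [v], their supremum
    would be a fixed point inside [(a, b)]. *)
Lemma push_past G g a b u v : germ_group G -> G g -> orb g a b -> a < u -> v < b ->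
  exists k k', [/\ G k, G k' & cancel k k'] /\
    [/\ cancel k' k, k a = a & v <= k u].
Proof.
move=> gG Gg gab au vb; have [ab ga gb gne] := gab.
have [uv|vu] := leP u v; last first.
  exists idfun, idfun; split; split => //; try exact: (gg_id gG); exact: ltW.
have [m [m' [[Gm Gm' mm'] [m'm ma um mab]]]] : exists m m',
    [/\ G m, G m' & cancel m m'] /\
    [/\ cancel m' m, m a = a, u < m u & orb m a b].
  have [g' [Gg' gg' g'g]] := gg_inv gG Gg.
  have := gne u ltac:(lra).
  have [lt|lt|//] := ltgtP (g u) u => _; last by exists g, g'.
  have g'a : g' a = a by rewrite -{1}ga gg'.
  have g'b : g' b = b by rewrite -{1}gb gg'.
  exists g', g; split; split => //; first by rewrite -(gg_ltE gG Gg) g'g.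
  by split => // t tab e; apply: (gne t tab); rewrite -{1}e g'g.
suff [N vN] : exists N, v <= iter N m u.
  exists (iter N m), (iter N m').
  have Giter h : G h -> G (iter N h).
    move=> Gh; elim: (N) => [|n IHn]; first exact: (gg_id gG).
    exact: (gg_comp gG Gh IHn).
  have canI h h' : cancel h h' -> cancel (iter N h) (iter N h').
    by move=> hh' t; elim: (N) => [//|n IHn]; rewrite iterSr iterS hh'.
  split; split; [exact: Giter|exact: Giter|exact: canI|exact: canI| |by []].
  by elim: (N) => //= n ->.
apply: contrapT => noN.
have lev n : iter n m u < v.
  by rewrite ltNge; apply/negP => vn; apply: noN; exists n.
pose S := range (fun n => iter n m u).
have hS : has_sup S.
  split; first by exists u, 0%N.
  by exists v => _ [n _ <-]; exact: ltW.
have inS n : iter n m u <= sup S by apply: ub_le_sup; [case: hS|exists n].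
have sv : sup S <= v by apply: ge_sup; [case: hS|move=> _ [n _ <-]; exact: ltW].
have us := inS 0%N; rewrite /= in us.
have [_ _ _ mne] := mab; apply: (mne (sup S)); first lra.
(* If [m] raised the supremum, the successor of an iterate above [m' (sup S)] would exceed it; if
   [m] lowered it, an iterate above [m (sup S)] has a larger successor, so it would exceed the
   supremum itself. *)
apply/eqP; rewrite eq_le !leNgt; apply/andP; split; apply/negP => lt.
  have : m' (sup S) < sup S by rewrite -(gg_ltE gG Gm) m'm.
  move=> /sup_gt => /(_ (proj1 hS))[_ [n _ <-]].
  by rewrite -(gg_ltE gG Gm) m'm -iterS ltNge inS.
have [_ [n _ <-]] := sup_gt (proj1 hS) lt.
have up : iter n m u < m (iter n m u).
  by elim: (n) => //= i; rewrite (gg_ltE gG Gm).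
move=> /lt_trans /(_ up); rewrite (gg_ltE gG Gm) ltNge.
by rewrite inS.
Qed.

Lemma mirror_id_near f b e :
  (forall t, 1 - b <= t <= 1 - b + e -> mirror f t = t) ->
  forall t, b - e <= t <= b -> f t = t.
Proof.
move=> H t tb; have := H (1 - t) ltac:(lra); rewrite /mirror subKr; lra.
Qed.

Lemma orb_derived_down G g f a b a' b' : germ_group G -> ~ one_sided G ->
  ~ one_sided (mirror_set G) -> G g -> G f ->
  orb g a b -> orb f a' b' -> a <= a' -> b' <= b -> (a', b') <> (a, b) ->
  exists2 c, derived G c & orb c a' b'.
Proof.
move=> gG nbad nbadm Gg Gf gab fab aa bb ne.
have [e e0 fe] := id_near_end gG nbad Gg Gf gab fab aa bb ne.
have [d d0 /mirror_id_near fd] : exists2 d, 0 < d &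
    forall t, 1 - b <= t <= 1 - b + d -> mirror f t = t.
  apply: (@id_near_end (mirror_set G) (mirror g) (mirror f) (1 - b) (1 - a)
    (1 - b') (1 - a')) => //; rewrite ?/mirror_set /= ?mirrorK //;
    [exact: mirror_group|exact: orb_mirror|exact: orb_mirror|lra|lra|].
  by move=> [e1 e2]; apply: ne; congr pair; lra.
have [ab' fa' fb' fne] := fab.
have ea : a + e <= a'.
  rewrite leNgt; apply/negP => lt.
  have e'0 : 0 < a + e - a' by lra.
  by apply: (orb_not_id e'0 _ fab) => t ta; apply: fe; lra.
have bd : b' <= b - d.
  rewrite leNgt; apply/negP => lt.
  have m1 : a' <= Num.max a' (b - d) by rewrite le_max lexx.
  have m2 : b - d <= Num.max a' (b - d) by rewrite le_max lexx orbT.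
  have m3 : Num.max a' (b - d) < b' by rewrite gt_max ab'.
  move: (Num.max _ _) m1 m2 m3 => m m1 m2 m3.
  by apply: (fne ((m + b') / 2)); [lra|apply: fd; lra].
(* Since [(a', b')] lies between [a + e] and [b - d], such a [k'] sends it into [[a, a + e]], where
   [f] is the identity. *)
have [k [k' [[Gk Gk' kk'] [k'k ka ku]]]] :
    exists k k', [/\ G k, G k' & cancel k k'] /\
      [/\ cancel k' k, k a = a & b - d <= k (a + e)].
  by apply: (push_past gG Gg gab); lra.
have [f' [Gf' ff' f'f]] := gg_inv gG Gf.
have k'a : k' a = a by rewrite -{1}ka kk'.
have cE t : a' <= t <= b' -> (k \o f' \o k' \o f) t = f t.
  move=> tab /=; have ft : a' <= f t <= b'.
    by rewrite -{1}fa' -{1}fb' !(gg_leE gG Gf).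
  suff /fe kf : a <= k' (f t) <= a + e by rewrite -{1}kf ff' k'k.
  rewrite -{1}k'a (gg_leE gG Gk') -[X in _ && X](gg_leE gG Gk) k'k.
  by apply/andP; split; lra.
exists (k \o f' \o k' \o f).
  by apply: cg_comm => //; apply/funext.
split => //; rewrite ?cE //; try lra.
by move=> t tab; rewrite cE; [exact: fne|lra].
Qed.

Lemma tower_derived_down G n a b : germ_group G -> tower_top G n.+1 a b ->
  exists a' b', tower_top (derived G) n a' b'.
Proof.
move=> gG tab.
have [/(one_sided_derived_tower n gG)//|nbad] := pselect (one_sided G).
have [bm|nbadm] := pselect (one_sided (mirror_set G)).
  have [a' [b' tab']] := one_sided_derived_tower n (mirror_group gG) bm.
  exists (1 - b'), (1 - a'); have := tower_top_mirror tab'.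
  rewrite derived_mirror; apply: tower_top_sub => f.
  by rewrite /mirror_set /= mirrorK.
have down m g a1 b1 a2 b2 : G g -> orb g a1 b1 -> tower_top G m a2 b2 ->
    a1 <= a2 -> b2 <= b1 -> (a2, b2) <> (a1, b1) ->
    exists2 c, derived G c & orb c a2 b2.
  move=> Gg gab /tower_top_orb[f Gf fab]; exact: orb_derived_down Gg Gf gab fab.
(* Only the top orbital is dropped: each other one lies strictly inside an orbital of [G], so the
   derived group realises it. Strict inclusion is carried along to stack the levels. *)
suff sub a1 b1 : tower_top G n.+1 a1 b1 -> exists a' b',
    [/\ tower_top (derived G) n a' b', a1 <= a', b' <= b1 & (a', b') <> (a1, b1)].
  by have [a' [b' []]] := sub _ _ tab; exists a', b'.
elim: n a1 b1 {a b tab} => [|n IHn] a b [[g Gg gab] [a' [b' [tab' aa bb ne]]]];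
  exists a', b'; split => //; split => //.
- exact: (down 0%N _ _ _ _ _ Gg gab tab' aa bb ne).
- exact: (down n.+1 _ _ _ _ _ Gg gab tab' aa bb ne).
- exact: IHn tab'.
Qed.

(** A tower counted by [n] has [n + 1] levels; for [n = 0] this says that a group without orbitals
    is trivial. The induction peels off the first derived group, so it ranges over all [G]. *)
Lemma derived_series_trivial G n : germ_group G ->
  derived_series G n = [set (fun x => x)] <-> ~ exists a b, tower_top G n a b.
Proof.
elim: n G => [|n IHn] G gG; last first.
  rewrite /derived_series iterSr -/(derived_series (derived G) n).
  rewrite (IHn _ (derived_group gG)); split => H [a [b tab]]; apply: H.
    exact: tower_derived_down tab.
  have [/(one_sided_tower n.+1 gG)//|nbad] := pselect (one_sided G).
  exact: tower_derived_up tab.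
rewrite /derived_series /=; split => [->[a [b [[_ -> [ab _ _ abn]] _]]]|ntw].
  by apply: (abn ((a + b) / 2)) => //; lra.
apply/seteqP; split => [f Gf|_ ->]; last exact: (gg_id gG).
apply/funext => x; apply: contrapT => /(orb_ex gG Gf)[a [b [fab _]]].
by apply: ntw; exists a, b; split => //; exists f.
Qed.

(** * Piecewise-linear homeomorphisms satisfy the abstract properties *)

(** The piece extends to the right of [p], as right germs require; [path_piece_gt] does the same for
    left germs. *)
Lemma path_piece_ge (s : seq R) x y p : path <%R x (rcons s y) -> x <= p < y ->
  exists2 ab, ab \in zip (x :: s) (rcons s y) & ab.1 <= p < ab.2.
Proof.
elim: s x => [|z s IHs] x /= => [_ xp|/andP[xz pz] /andP[xp py]].
  by exists (x, y); rewrite ?mem_seq1.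
have [zp|pz'] := leP z p; last by exists (x, z); rewrite ?mem_head //= xp.
have [ab abs pab] := IHs z pz ltac:(by rewrite zp).
by exists ab => //; rewrite in_cons abs orbT.
Qed.

Lemma path_piece_gt (s : seq R) x y p : path <%R x (rcons s y) -> x < p <= y ->
  exists2 ab, ab \in zip (x :: s) (rcons s y) & ab.1 < p <= ab.2.
Proof.
elim: s x => [|z s IHs] x /= => [_ xp|/andP[xz pz] /andP[xp py]].
  by exists (x, y); rewrite ?mem_seq1.
have [zp|pz'] := ltP z p; last by exists (x, z); rewrite ?mem_head //= xp.
have [ab abs pab] := IHs z pz ltac:(by rewrite zp).
by exists ab => //; rewrite in_cons abs orbT.
Qed.

(** At 0 and 1 themselves this follows because [f] maps [[0, 1]] increasingly onto itself. *)
Lemma PLo_out f x : is_PLo f -> x <= 0 \/ 1 <= x -> f x = x.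
Proof.
move=> [fout [fmono [_ [fim _]]]].
have inI t : unitI t -> t \in (@unitI R) by move/mem_set.
have fI t : unitI t -> unitI (f t) by move=> It; rewrite -fim; exists t.
have I0 : (@unitI R) 0 by rewrite /unitI /= lexx ler01.
have I1 : (@unitI R) 1 by rewrite /unitI /= lexx ler01.
have f0 : f 0 = 0.
  have := I0; rewrite -{1}fim => -[y Iy fy].
  have [y0|y0] := leP y 0.
    rewrite -[in LHS](_ : y = 0) //; move: Iy; rewrite /unitI /=; lra.
  have := fmono 0 y (inI _ I0) (inI _ Iy) y0.
  by have := fI 0 I0; rewrite fy /unitI /=; lra.
have f1 : f 1 = 1.
  have := I1; rewrite -{1}fim => -[y Iy fy].
  have [y1|y1] := leP 1 y.
    rewrite -[in LHS](_ : y = 1) //; move: Iy; rewrite /unitI /=; lra.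
  have := fmono y 1 (inI _ Iy) (inI _ I1) y1.
  by have := fI 1 I1; rewrite fy /unitI /=; lra.
move=> x01; have [->//|x0] := eqVneq x 0; have [->//|x1] := eqVneq x 1.
apply: fout; rewrite /unitI /= => Ix.
have /orP : (x == 0) || (x == 1).
  by case: x01 => ?; apply/orP; [left|right]; apply/eqP; lra.
by rewrite (negbTE x0) (negbTE x1); case.
Qed.

Lemma PLo_lt f : is_PLo f -> {homo f : x y / x < y}.
Proof.
move=> Pf; have fo := PLo_out Pf; have [_ [fmono [_ [fim _]]]] := Pf.
have fI t : 0 <= t <= 1 -> 0 <= f t <= 1.
  by move=> It; have : unitI (f t) by rewrite -fim; exists t.
have mon x y : 0 <= x <= 1 -> 0 <= y <= 1 -> x < y -> f x < f y.
  by move=> Ix Iy; apply: fmono; apply/mem_set.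
move=> x y xy; have [x0|x0] := ltP x 0.
  rewrite (fo x); last by left; lra.
  have [y0|y0] := ltP y 0; first by rewrite fo //; left; lra.
  have [y1|y1] := ltP 1 y; first by rewrite fo //; right; lra.
  by have := fI y ltac:(lra); lra.
have [x1|x1] := ltP 1 x; first by rewrite !fo //; right; lra.
have [y1|y1] := ltP 1 y; last by apply: mon => //; lra.
rewrite (fo y); last by right; lra.
by have := fI x ltac:(lra); lra.
Qed.

Lemma PLo_germ f p : is_PLo f -> f p = p -> exists l, rgerm f p l.
Proof.
move=> Pf fp; have fo := PLo_out Pf; have [_ [_ [_ [_ [s [ps fs]]]]]] := Pf.
have [p0|p0] := ltP p 0.
  exists 1, (- p); first lra.
  by move=> t pt; rewrite fo; [lra|left; lra].
have [p1|p1] := leP 1 p.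
  exists 1, 1; first lra.
  by move=> t pt; rewrite fo; [lra|right; lra].
have [ab /fs[m [c fmc]] /andP[ap pb]] := path_piece_ge (p := p) ps ltac:(lra).
exists m, (ab.2 - p); first lra.
move=> t pt; have := fmc p ltac:(lra); rewrite fp fmc; last lra.
by lra.
Qed.

Lemma PLo_mgerm f p : is_PLo f -> mirror f p = p ->
  exists l, rgerm (mirror f) p l.
Proof.
move=> Pf fp; have fo := PLo_out Pf; have [_ [_ [_ [_ [s [ps fs]]]]]] := Pf.
have fq : f (1 - p) = 1 - p by move: fp; rewrite /mirror; lra.
have [p0|p0] := ltP p 0.
  exists 1, (- p); first lra.
  by move=> t pt; rewrite /mirror fo; [lra|right; lra].
have [p1|p1] := leP 1 p.
  exists 1, 1; first lra.
  by move=> t pt; rewrite /mirror fo; [lra|left; lra].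
have [ab /fs[m [c fmc]] /andP[ap pb]] :=
  path_piece_gt (p := 1 - p) ps ltac:(lra).
exists m, (1 - p - ab.1); first lra.
move=> t pt; rewrite /mirror.
have := fmc (1 - p) ltac:(lra); rewrite fq fmc; last lra.
by lra.
Qed.

Lemma subgroup_germ_group G : is_subgroup_PLo G -> germ_group G.
Proof.
move=> [GP [G1 [GM GV]]]; split=> // [f Gf|f x Gf x0|f x Gf x1|f p Gf|f p Gf|f Gf].
- exact: PLo_lt (GP _ Gf).
- by apply: PLo_out (GP _ Gf) _; left.
- by apply: PLo_out (GP _ Gf) _; right.
- exact: PLo_germ (GP _ Gf).
- exact: PLo_mgerm (GP _ Gf).
- have [h [Gh [fh hf]]] := GV f Gf; exists h; split => // t.
    exact: (congr1 (@^~ t) hf).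
  exact: (congr1 (@^~ t) fh).
Qed.

(** * Comparison with towers of signed orbitals *)

Definition oint a b : set R := [set t | a < t < b].

Lemma oint_sub a b c d : a < b -> oint a b `<=` oint c d -> c <= a /\ b <= d.
Proof.
move=> ab sub; split; rewrite leNgt; apply/negP => lt.
  have m1 : a < Num.min b c by rewrite lt_min ab.
  have m2 : Num.min b c <= b by rewrite ge_min lexx.
  have m3 : Num.min b c <= c by rewrite ge_min lexx orbT.
  move: (Num.min b c) m1 m2 m3 => m m1 m2 m3.
  by have := sub ((a + m) / 2); rewrite /oint /= => /(_ ltac:(lra)); lra.
have m1 : a <= Num.max a d by rewrite le_max lexx.
have m2 : d <= Num.max a d by rewrite le_max lexx orbT.
have m3 : Num.max a d < b by rewrite gt_max ab.
move: (Num.max a d) m1 m2 m3 => m m1 m2 m3.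
by have := sub ((b + m) / 2); rewrite /oint /= => /(_ ltac:(lra)); lra.
Qed.

(** A connected subset of the support is an interval that avoids the fixed points [a] and [b]. *)
Lemma orb_component f a b x : orb f a b -> a < x < b ->
  connected_component (supp f) x = oint a b.
Proof.
move=> [ab fa fb fne] xab; apply/seteqP; split => [t [C [Cx Csub] Cco] Ct|t tab].
  have /connected_intervalP Ci := Cco.
  have noend z : f z = z -> ~ C z by move=> fz /Csub.
  apply/andP; split; rewrite ltNge; apply/negP => le.
    by apply: (noend a fa); apply: (Ci t x) => //; rewrite le; lra.
  by apply: (noend b fb); apply: (Ci x t) => //; rewrite le andbT; lra.
apply: (@connected_component_max _ _ (oint a b)); [exact: xab| | |exact: tab].
- by move=> z zab; exact: (fne z zab).
- apply/connected_intervalP => u v; rewrite /oint /= => uab vab z uzv; lra.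
Qed.

Lemma orbitalE G f A : germ_group G -> G f ->
  orbital f A <-> exists a b, orb f a b /\ A = oint a b.
Proof.
move=> gG Gf; split => [[x [fx ->]]|[a [b [fab ->]]]].
  have [a [b [fab xab]]] := orb_ex gG Gf fx.
  by exists a, b; split => //; exact: orb_component.
have [ab _ _ fne] := fab.
have mab : a < (a + b) / 2 < b by lra.
exists ((a + b) / 2); split; first exact: (fne _ mab).
by rewrite (orb_component fab mab).
Qed.

Lemma tower_top_tower G n a b : germ_group G -> tower_top G n a b ->
  exists T, tower G T /\ (T #= `I_n.+1)%card.
Proof.
move=> gG tab.
(* Levels are numbered from the smallest orbital, so that a new top gets the next index. *)
have [f [fG fS _]] : exists f : nat -> set R * (R -> R),
    [/\ forall i, (i <= n)%N -> G (f i).2 /\ orbital (f i).2 (f i).1,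
     forall i j, (i < j <= n)%N -> (f i).1 `<=` (f j).1 /\ (f i).1 <> (f j).1 &
     (f n).1 = oint a b].
  elim: n a b tab => [|n IHn] a b [[g Gg gab]].
    exists (fun=> (oint a b, g)); split => // [i _|i j].
      by split => //; apply/(orbitalE _ gG Gg); exists a, b.
    by case: j => // j; rewrite ltn0 andbF.
  move=> [a' [b' [/[dup] /tower_top_orb[g' _ [ab' _ _ _]] /IHn[f [fG fS fn]] aa bb ne]]].
  exists (fun i => if (i <= n)%N then f i else (oint a b, g)).
  have sub' : oint a' b' `<=` oint a b by move=> t; rewrite /oint /=; lra.
  have ne' : oint a' b' <> oint a b.
    move=> e; have [] := @oint_sub a b a' b'; [by have [] := gab|by rewrite e|].
    by move=> ? ?; apply: ne; congr pair; lra.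
  split => [i|i j /andP[ij]|]; last by rewrite ltnn.
    move=> _; case: (leqP i n) => [iln|_]; first exact: fG.
    split => //.
    by apply/(orbitalE _ gG Gg); exists a, b.
  rewrite leq_eqVlt => /orP[/eqP jn|]; last first.
    rewrite ltnS => jn; rewrite jn (leq_trans (ltnW ij) jn).
    by apply: fS; rewrite ij.
  rewrite jn ltnn; have iln : (i <= n)%N by rewrite -ltnS -jn.
  rewrite iln /=; move: iln; rewrite leq_eqVlt => /orP[/eqP ->|iln].
    by rewrite fn.
  have [] := fS i n ltac:(by rewrite iln /=); rewrite fn => s1 n1.
  split; first exact: subset_trans s1 sub'.
  by move=> e; apply: ne'; apply/seteqP; split => //; rewrite -e.
have inj i j : (i <= n)%N -> (j <= n)%N -> (f i).1 = (f j).1 -> i = j.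
  move=> iln jln e; have [lt|lt|//] := ltngtP i j.
    by have [_ /(_ e)] := fS i j ltac:(by rewrite lt).
  by have [_ /(_ (esym e))] := fS j i ltac:(by rewrite lt).
exists (f @` `I_n.+1); split; last first.
  apply: inj_card_eq => i j; rewrite !inE /= => iln jln e.
  by apply: inj => //; rewrite e.
split => [_ [i iln <-]|]; first exact: fG.
split => _ _ [i iln <-] [j jln <-] => [e|]; first by rewrite (inj i j).
have [lt|lt|->] := ltngtP i j; last by left.
  by left; have [] := fS i j ltac:(by rewrite lt).
by right; have [] := fS j i ltac:(by rewrite lt).
Qed.

Lemma sorted_tower_top G (s : seq (R * R)) p :
  path [rel p q : R * R | (p.1 <= q.1) && (q.2 <= p.2)] p s -> uniq (p :: s) ->
  (forall q, q \in p :: s -> exists2 g, G g & orb g q.1 q.2) ->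
  tower_top G (size s) p.1 p.2.
Proof.
elim: s p => [|q s IHs] p.
  by move=> _ _ /(_ p); rewrite mem_head => /(_ isT).
rewrite /= => /andP[/andP[pq1 pq2] qs] /andP[pqs us] Go; split.
  by apply: Go; rewrite mem_head.
exists q.1, q.2; split => //.
  by apply: IHs => // r rs; apply: Go; rewrite in_cons rs orbT.
rewrite -!surjective_pairing => e; move: pqs.
by rewrite e mem_head.
Qed.

(** Choose [n + 1] elements of the tower, read off the end points and sort them by decreasing
    interval. The intervals are distinct because each orbital occurs once in [T]. *)
Lemma tower_tower_top G T n : germ_group G -> tower G T -> (`I_n.+1 #<= T)%card ->
  exists a b, tower_top G n a b.
Proof.
move=> gG [TG [Tinj Tcomp]] /pcard_leP/unsquash f.
have fT i : (i < n.+1)%N -> T (f i) by move=> iln; exact: (@funS _ _ _ _ f).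
have /choice[e eP] : forall i, exists p : R * R, (i < n.+1)%N ->
    exists g, [/\ G g, orb g p.1 p.2 & (f i).1 = oint p.1 p.2].
  (* The pair [(0, 0)] is a default for indices out of range. *)
  move=> i; have [iln|] := boolP (i < n.+1)%N; last by exists (0, 0).
  have [Gf /(orbitalE _ gG Gf)[a [b [fab eab]]]] := TG _ (fT i iln).
  by exists (a, b) => _; exists (f i).2.
pose s := [seq e i | i <- iota 0 n.+1].
have sP q : q \in s -> exists i, (i < n.+1)%N /\ q = e i.
  by move=> /mapP[i]; rewrite mem_iota add0n => iln ->; exists i.
have us : uniq s.
  rewrite map_inj_in_uniq ?iota_uniq // => i j.
  rewrite !mem_iota !add0n /= => iln jln eij.
  apply: (@inj _ _ _ f); rewrite ?inE //; apply: Tinj; [exact: fT|exact: fT|].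
  have [g [_ _ ->]] := eP i iln; have [h [_ _ ->]] := eP j jln.
  by rewrite eij.
pose r := [rel p q : R * R | (p.1 <= q.1) && (q.2 <= p.2)].
have rtot : {in [in s] &, total r}.
  move=> _ _ /sP[i [iln ->]] /sP[j [jln ->]].
  have [g [_ [gab _ _ _] ei]] := eP i iln.
  have [h [_ [hab _ _ _] ej]] := eP j jln.
  have := Tcomp _ _ (fT i iln) (fT j jln); rewrite ei ej /r /=.
  by move=> [/(oint_sub gab)[-> ->]|/(oint_sub hab)[-> ->]]; rewrite ?orbT.
have := sort_sorted_in rtot (allss s).
have : size (sort r s) = n.+1 by rewrite size_sort size_map size_iota.
have : uniq (sort r s) by rewrite sort_uniq.
have : forall q, q \in sort r s -> exists2 g, G g & orb g q.1 q.2.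
  by move=> q; rewrite mem_sort => /sP[i [/eP[g [Gg gab _]] ->]]; exists g.
case: (sort r s) => // p t Go ut [<-] pt.
by exists p.1, p.2; exact: sorted_tower_top.
Qed.

Lemma has_depthE G n : germ_group G -> has_depth G n <->
  (~ exists a b, tower_top G n a b) /\
  forall m, (m < n)%N -> exists a b, tower_top G m a b.
Proof.
move=> gG; split => [[[T [towT cT]] le]|[ntw tws]].
  split=> [[a [b /(tower_top_tower gG)[T' [towT' cT']]]]|m mn].
    have := le _ towT'; rewrite (card_le_eql cT') card_le_II.
    by rewrite ltnn.
  apply: (tower_tower_top gG towT); rewrite (card_le_eqr cT) card_le_II.
  exact: mn.
split.
  case: n ntw tws => [_ _|n _ /(_ n (ltnSn n))[a [b tab]]].
    exists set0; split; first by split => //; split.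
    by rewrite II0.
  exact: tower_top_tower tab.
move=> T towT; apply: contrapT => nle; apply: ntw; apply: (tower_tower_top gG towT).
(* A set that does not embed in [n] points has at least [n + 1] elements, whether finite or not. *)
have [/finite_setP[m cm]|/infiniteP] := pselect (finite_set T); last first.
  by apply: card_le_trans; exact: card_leT.
move: nle; rewrite (card_le_eql cm) (card_le_eqr cm) !card_le_II.
by move=> /negP; rewrite -ltnNge.
Qed.
End PLgroups.

Theorem theorem5 (R : realType) (G : set (R -> R)) (n : nat) :
  is_subgroup_PLo G ->
  (solvable_derived_length G n <-> has_depth G n).
Proof.
move=> /subgroup_germ_group gG; rewrite (has_depthE _ gG).
rewrite /solvable_derived_length (derived_series_trivial _ gG).
split=> -[ntw H]; split => // m /H.
  by move=> Hm; apply: contrapT => /(derived_series_trivial _ gG).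
by move=> tab /(derived_series_trivial _ gG).
Qed.
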